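(* Let $p\ge 1$ be an integer, let $c_1,c_2>0$ and $\gamma_2\ge 0$ be real constants, and let $x$ and $\gamma_1$ be nonnegative real random variables such that the conditional distribution of $x$ given $\gamma_1$ is $c_1\chi^2(p,\gamma_1/c_1)$ and the distribution of $\gamma_1$ is $c_2\chi^2(p,\gamma_2/c_2)$. Then the (unconditional) distribution of $x$ is \[x\sim(c_1+c_2)\,\chi^2\!\left(p,\frac{\gamma_2}{c_1+c_2}\right).\]
   Context: For an integer $p\ge1$ and $\lambda\ge 0$, $\chi^2(p,\lambda)$ denotes the noncentral chi-square distribution with $p$ degrees of freedom and noncentrality parameter $\lambda$, i.e. the distribution of $\sum_{i=1}^p Z_i^2$ where $Z_1,\dots,Z_p$ are independent, $Z_i\sim N(\mu_i,1)$ and $\sum_{i=1}^p\mu_i^2=\lambda$ (this distribution depends on the $\mu_i$ only through $\lambda$). With this normalization its moment generating function is $(1-2t)^{-p/2}\exp\left[\lambda t/(1-2t)\right]$ for $t<1/2$. For $c>0$, $c\,\chi^2(p,\lambda)$ denotes the distribution of $cW$ where $W\sim\chi^2(p,\lambda)$. The statement that the conditional distribution of $x$ given $\gamma_1$ is $c_1\chi^2(p,\gamma_1/c_1)$ means that a regular conditional distribution of $x$ given $\gamma_1=g$ is $c_1\chi^2(p,g/c_1)$ for almost every value $g$ of $\gamma_1$. *)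

(* Defs.v *)
From HB Require Import structures.
From mathcomp Require Import all_boot all_order all_algebra.
From mathcomp Require Import all_classical all_reals all_analysis.

Set Implicit Arguments.
Unset Strict Implicit.
Unset Printing Implicit Defensive.

Import Order.TTheory GRing.Theory Num.Theory.
Import numFieldNormedType.Exports.

Local Open Scope classical_set_scope.
Local Open Scope ring_scope.

(* Laws are compared on Borel sets only. *)
Definition same_law (R : realType) (m1 m2 : set R -> \bar R) : Prop :=
  forall B : set R, measurable B -> m1 B = m2 B.

Definition mutually_independent (R : realType) (d : measure_display)
    (T : measurableType d) (P : probability T R) (I : finType)
    (Z : I -> {RV P >-> R}) : Prop :=
  forall (J : {set I}) (B : I -> set R), (forall i, measurable (B i)) ->
    P (\bigcap_(i in [set` J]) (Z i @^-1` B i)) =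
    (\prod_(i in J) P (Z i @^-1` B i))%E.

(* [noncentral_chi2 p lam nu]: nu is the law chi^2(p, lam). The means m i are
   any reals with sum of squares lam; no particular choice is imposed, as the
   resulting law depends on them only through lam. There is no such law when
   lam < 0. *)
Definition noncentral_chi2 (R : realType) (p : nat) (lam : R)
    (nu : set R -> \bar R) : Prop :=
  exists (d : measure_display) (T : measurableType d) (P : probability T R)
         (Z : 'I_p -> {RV P >-> R}) (m : 'I_p -> R),
    [/\ mutually_independent Z,
        forall i, same_law (distribution P (Z i)) (normal_prob (m i) 1),
        \sum_(i < p) m i ^+ 2 = lam
      & same_law nu (pushforward P (fun t => \sum_(i < p) Z i t ^+ 2))].

(* [scaled_noncentral_chi2 c p lam nu]: nu is the law c chi^2(p, lam), that is,
   the law of c W for W distributed as chi^2(p, lam). *)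
Definition scaled_noncentral_chi2 (R : realType) (c : R) (p : nat) (lam : R)
    (nu : set R -> \bar R) : Prop :=
  exists (d : measure_display) (T : measurableType d) (P : probability T R)
         (W : {RV P >-> R}),
    noncentral_chi2 p lam (distribution P W) /\
    same_law nu (pushforward P (fun t => c * W t)).

(* [regular_conditional_distribution X Y k]: the probability kernel k is a
   version of the law of X given Y, i.e. y |-> k y A is a version of
   P(X \in A | Y = y) for every Borel A. *)
Definition regular_conditional_distribution (R : realType)
    (d : measure_display) (T : measurableType d) (P : probability T R)
    (X Y : {RV P >-> R})
    (k : R.-pker (measurableTypeR R) ~> (measurableTypeR R)) : Prop :=
  forall A B : set R, measurable A -> measurable B ->
    P (X @^-1` A `&` Y @^-1` B) = (\int[distribution P Y]_(y in B) k y A)%E.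

(* Main.v *)
Require Import Defs.
From HB Require Import structures.
From mathcomp Require Import all_boot all_order all_algebra.
From mathcomp Require Import all_classical all_reals all_analysis.
From mathcomp Require Import measurable_realfun ring lra.

(* Everything is read off Laplace transforms. Completing the square gives
   E exp(-s Z^2) = (1 + 2s)^(-1/2) exp(-m^2 s / (1 + 2s)) for Z ~ N(m, 1), so by
   independence c chi^2(p, a/c) has Laplace transform
     L_c,a(s) = (1 + 2cs)^(-p/2) exp(-a s / (1 + 2cs)).
   Conditionally on gamma_1 = g, x has transform L_c1,g(s), which is a constant
   times exp(-g s'), s' = s / (1 + 2 c1 s); integrating over gamma_1 gives that
   constant times L_c2,gamma2(s'), and this is L_(c1+c2),gamma2(s).
   A law on [0, +oo[ is determined by its Laplace transform at the natural
   numbers because (1 - e^(-nx))^N, with N = floor(n e^(na)), is a polynomial in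
   e^(-x) that converges boundedly to the indicator of x > a.
   Finally, a probability space carrying the target law is obtained from the one
   given for gamma_1 by translating its normal variables. *)

Set Implicit Arguments.
Unset Strict Implicit.
Unset Printing Implicit Defensive.

Import Order.TTheory GRing.Theory Num.Theory.
Import numFieldNormedType.Exports.

Local Open Scope classical_set_scope.
Local Open Scope ring_scope.

(** * Integration against mixtures and weighted images of measures *)

Section mixtures.
Local Open Scope ereal_scope.
Import HBNNSimple.

(** The hypothesis on [nu] is the case of an indicator. Linearity gives simple functions, and
    monotone convergence, under [nu], under each [k y] and under [mu], gives the rest. *)
Lemma integral_mixture (R : realType) (d1 d2 : measure_display)
    (T1 : measurableType d1) (T2 : measurableType d2)
    (mu : {measure set T1 -> \bar R}) (k : T1 -> {measure set T2 -> \bar R})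
    (nu : {measure set T2 -> \bar R}) (f : T2 -> \bar R) :
  (forall A, measurable A ->
    measurable_fun [set: T1] (fun y => k y A : \bar R)) ->
  (forall A, measurable A -> nu A = \int[mu]_y k y A) ->
  measurable_fun [set: T2] f -> (forall x, 0 <= f x) ->
  \int[nu]_x f x = \int[mu]_y \int[k y]_x f x.
Proof.
move=> mk nuE mf f0.
pose g := nnsfun_approx measurableT mf.
pose gE := fun n => EFin \o g n.
have mgE n : measurable_fun [set: T2] (gE n) by exact/measurable_EFinP.
have gE_ge0 n x : 0 <= gE n x by rewrite lee_fin.
have nd_gE x : {homo gE ^~ x : n m / (n <= m)%O >-> n <= m}.
  by move=> *; exact/lefP/nd_nnsfun_approx.
have nusimple n : \int[nu]_x gE n x = \int[mu]_y \int[k y]_x gE n x.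
  rewrite integralT_nnsfun sintegralE.
  under [RHS]eq_integral do rewrite integralT_nnsfun sintegralE.
  rewrite ge0_integral_fsum//; last 2 first.
  - by move=> r; apply: measurable_funeM; exact: mk.
  - by move=> r x _; exact: nnsfun_mulemu_ge0.
  apply: eq_fsbigr => r rg; rewrite nuE// ge0_integralZl//.
  - exact: mk.
  - by rewrite lee_fin; move: rg; rewrite inE => -[x _ <-].
transitivity (limn (fun n => \int[nu]_x gE n x)).
  rewrite -monotone_convergence//; apply: eq_integral => t _.
  by apply/esym/cvg_lim => //; exact: cvg_nnsfun_approx.
transitivity (limn (fun n => \int[mu]_y \int[k y]_x gE n x)).
  by apply: congr_lim; apply/funext => n; exact: nusimple.
rewrite -monotone_convergence//; last 3 first.
- by move=> n; exact: measurable_fun_integral_kernel.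
- by move=> n x _; exact: integral_ge0.
- by move=> x _ m n mn; apply: ge0_le_integral => // t _; exact: nd_gE.
apply: eq_integral => y _; rewrite -monotone_convergence//.
by apply: eq_integral => t _; apply/cvg_lim => //; exact: cvg_nnsfun_approx.
Qed.

(** Such a [nu] is the mixture over [mu] of the point masses at [Z t] with weight [h t]. *)
Lemma integral_weighted_law (R : realType) (d1 d2 : measure_display)
    (T1 : measurableType d1) (T2 : measurableType d2)
    (mu : {measure set T1 -> \bar R}) (h : T1 -> R) (Z : T1 -> T2)
    (nu : {measure set T2 -> \bar R}) (f : T2 -> \bar R) :
  measurable_fun [set: T1] h -> (forall t, 0 <= h t)%R ->
  measurable_fun [set: T1] Z ->
  (forall A, measurable A -> nu A = \int[mu]_t ((h t)%:E * (\1_A (Z t))%:E)) ->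
  measurable_fun [set: T2] f -> (forall x, 0 <= f x) ->
  \int[nu]_x f x = \int[mu]_t ((h t)%:E * f (Z t)).
Proof.
move=> mh h0 mZ nuE mf f0.
pose k t : {measure set T2 -> \bar R} := mscale (NngNum (h0 t)) \d_(Z t).
have kE t A : k t A = (h t)%:E * (\1_A (Z t))%:E by [].
rewrite (@integral_mixture _ _ _ _ _ mu k)//.
- apply: eq_integral => t _.
  by rewrite /k ge0_integral_mscale//= integral_dirac// diracT mul1e.
- move=> A mA; under eq_fun do rewrite kE.
  apply: emeasurable_funM; apply/measurable_EFinP => //.
  exact: measurableT_comp.
Qed.

End mixtures.

(** * Expectation of a product of independent factors *)

Lemma integrable_unit_valued (R : realType) (d : measure_display)
    (T : measurableType d) (P : probability T R) (f : T -> R) :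
  measurable_fun [set: T] f -> (forall t, 0 <= f t <= 1) ->
  P.-integrable [set: T] (EFin \o f).
Proof.
move=> mf f01; apply: measurable_bounded_integrable => //.
  by rewrite (le_lt_trans (probability_le1 P measurableT))// ltry.
exists 1; split; first exact: num_real.
move=> M M1 t _ /=; have /andP[f0 f1] := f01 t.
by rewrite ger0_norm// (le_trans f1)// ltW.
Qed.

(* The functions are exchanged one at a time for indicators, for which the
   identity is the definition of independence. *)
Lemma expectation_prod_indep (R : realType) (d : measure_display)
    (T : measurableType d) (P : probability T R) (I : finType)
    (Z : I -> {RV P >-> R}) (f : I -> R -> R) :
  mutually_independent Z ->
  (forall i, measurable_fun [set: R] (f i)) ->
  (forall i x, 0 <= f i x <= 1) ->
  (\int[P]_t (\prod_i f i (Z i t))%:E =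
   \prod_i \int[P]_t (f i (Z i t))%:E)%E.
Proof.
(* The list [r] holds the indices whose function may fail to be an indicator; the induction empties
   it. *)
move=> indZ; have [r] : exists r : seq I,
    forall i, i \in r \/ exists2 B, measurable B & f i = \1_B.
  by exists (enum I) => i; left; rewrite mem_enum.
elim: r f => [|j r IHr] f rf mf f01.
  have /choice[B fB] : forall i, exists B, measurable B /\ f i = \1_B.
    by move=> i; case: (rf i) => // -[B]; exists B.
  have mB i : measurable (B i) by case: (fB i).
  have fE i x : f i x = \1_(B i) x by case: (fB i) => _ ->.
  have mZB i : measurable (Z i @^-1` B i) by exact: measurable_funPTI.
  have PB := indZ [set: I]%SET B mB.
  have capE : \bigcap_(i in [set` [set: I]%SET]) (Z i @^-1` B i) =
      [set t | forall i, B i (Z i t)].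
    apply/seteqP; split => t /= H i; last by move=> _; exact: H.
    by apply: H; rewrite /= inE.
  rewrite capE in PB.
  transitivity (P [set t | forall i, B i (Z i t)]).
    rewrite -[in RHS](setIT [set t | _]) -integral_indic//; last first.
      by rewrite -capE; exact: fin_bigcap_measurable.
    apply: eq_integral => t _; congr EFin.
    rewrite indicE; have [/[!inE]/= tB|tB] := boolP (t \in _).
      by rewrite big1// => i _; rewrite fE indicE mem_set.
    have [k tBk] : exists k, ~ B k (Z k t).
      by apply/existsNP; apply: contraNnot tB => tB; rewrite inE.
    by rewrite (bigD1 k)//= fE indicE memNset// mul0r.
  rewrite PB; apply: eq_big => [i|i _]; first by rewrite inE.
  under eq_integral do rewrite fE.
  rewrite (_ : (fun _ => _) = (EFin \o \1_(Z i @^-1` B i)))//.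
  by rewrite integral_indic// setIT.
(* With the other functions fixed, both sides are integrals of [f j]: on the left against the image
   under [Z j] of [P] weighted by [h], on the right against [C] times the law of [Z j]. It suffices
   that these two measures agree on every Borel set [A]. *)
pose h t := \prod_(i | i != j) f i (Z i t).
have f0 i x : 0 <= f i x by case/andP: (f01 i x).
have fp i : (\int[P]_t (f i (Z i t))%:E)%E \is a fin_num.
  apply: integrable_fin_num => //.
  apply: (@integrable_unit_valued _ _ _ P (f i \o Z i)) => //.
  - exact: measurableT_comp.
  - by move=> t; exact: f01.
pose C := \prod_(i | i != j) fine (\int[P]_t (f i (Z i t))%:E)%E.
have C0 : 0 <= C.
  apply: prodr_ge0 => i _; apply/fine_ge0/integral_ge0 => t _.
  by rewrite lee_fin.
pose nu : {measure set R -> \bar R} :=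
  mscale (NngNum C0) (distribution P (Z j)).
have h0 t : 0 <= h t by apply: prodr_ge0.
have mh : measurable_fun [set: T] h.
  rewrite /h; under eq_fun do rewrite -big_filter.
  by apply: measurable_prod => i _; exact: measurableT_comp.
have CE : C%:E = (\prod_(i | i != j) \int[P]_t (f i (Z i t))%:E)%E.
  by rewrite -prodEFin; apply: eq_bigr => i _; rewrite fineK.
transitivity (\int[nu]_x (f j x)%:E)%E.
  rewrite (@integral_weighted_law _ _ _ _ _ P h (Z j) nu)//.
  - by apply: eq_integral => t _; rewrite (bigD1 j)//= -EFinM mulrC.
  - move=> A mA.
    (* Replacing [f j] by the indicator of [A] removes [j] from the list, so the induction
       hypothesis applies to [g]. *)
    pose g i := if i == j then \1_A : R -> R else f i.
    have gj : g j = \1_A by rewrite /g eqxx.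
    have gi i : i != j -> g i = f i by rewrite /g; case: eqP.
    transitivity (\prod_i \int[P]_t (g i (Z i t))%:E)%E; last first.
      rewrite -IHr.
      + apply: eq_integral => t _; rewrite (bigD1 j)//= gj -EFinM mulrC.
        by congr (_ * _)%:E; apply: eq_bigr => i ij; rewrite gi.
      + move=> i; have [->|ij] := eqVneq i j; first by right; exists A.
        by rewrite gi//; case: (rf i); [rewrite inE (negbTE ij); left | right].
      + move=> i; have [->|ij] := eqVneq i j; last by rewrite gi.
        by rewrite gj.
      + move=> i x; have [->|ij] := eqVneq i j; last by rewrite gi.
        by rewrite gj indicE; case: (_ \in _); rewrite ?lexx ?ler01.
    rewrite (bigD1 j)//= gj muleC.
    rewrite (_ : \int[P]_t _ = distribution P (Z j) A)%E; last first.
      rewrite (_ : (fun _ => _) = (EFin \o \1_(Z j @^-1` A)))//.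
      by rewrite integral_indic// ?setIT//; exact: measurable_funPTI.
    rewrite /nu/= /mscale/= CE; congr (_ * _)%E.
    by apply: eq_bigr => i ij; rewrite gi.
  - exact/measurable_EFinP.
  - by move=> x; rewrite lee_fin.
rewrite /nu ge0_integral_mscale//=; last 2 first.
- exact/measurable_EFinP.
- by move=> x _; rewrite lee_fin.
rewrite [RHS](bigD1 j)//= muleC CE; congr (_ * _)%E.
rewrite ge0_integral_distribution//; first exact/measurable_EFinP.
by move=> x; rewrite lee_fin.
Qed.

(** * Image measures and normal laws *)

(* The codomain of a random variable is R with its default measurable structure,
   whereas [normal_prob] and the kernels live on [measurableTypeR R]: the
   sigma-algebras agree but the displays differ, so laws have to be repackaged
   as measures on [measurableTypeR R]. *)
Definition image_measure (R : realType) (d1 d2 : measure_display)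
    (T1 : measurableType d1) (T2 : measurableType d2)
    (mu : {measure set T1 -> \bar R}) (f : T1 -> T2)
    (mf : measurable_fun [set: T1] f) : {measure set T2 -> \bar R} :=
  measure_function_pushforward__canonical__measure_function_Measure mu mf.

Lemma ge0_integral_law (R : realType) (d1 d2 : measure_display)
    (T1 : measurableType d1) (T2 : measurableType d2)
    (mu : {measure set T1 -> \bar R}) (Z : T1 -> T2)
    (nu : {measure set T2 -> \bar R}) (f : T2 -> \bar R) :
  measurable_fun [set: T1] Z ->
  (forall A, measurable A -> nu A = mu (Z @^-1` A)) ->
  measurable_fun [set: T2] f -> (forall x, 0 <= f x)%E ->
  (\int[nu]_x f x = \int[mu]_t f (Z t))%E.
Proof.
move=> mZ nuE mf f0.
rewrite -[RHS](ge0_integral_pushforward mZ _ measurableT)//.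
by apply: eq_measure_integral => A mA _; exact: nuE.
Qed.

(** Lebesgue measure is determined by its values on half-open intervals, whose length a translation
    preserves. *)
Lemma lebesgue_measure_translation (R : realType) (a : R)
    (A : set (measurableTypeR R)) :
  measurable A ->
  pushforward (@lebesgue_measure R) (fun x => x + a) A = lebesgue_measure A.
Proof.
move=> mA.
have mf : measurable_fun [set: measurableTypeR R]
    (fun x : measurableTypeR R => x + a : measurableTypeR R).
  exact: measurable_funD.
pose nu : {measure set (measurableTypeR R) -> \bar R} :=
  image_measure (@lebesgue_measure R) mf.
rewrite -(@lebesgue_measure_unique R nu)// => _ [[b c] /= _ <-].
rewrite /nu/= /pushforward.
rewrite (_ : _ @^-1` _ = `]b - a, c - a]%classic); last first.
  by apply/seteqP; split => x /=; rewrite !in_itv/= ltrBlDr lerBrDr.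
rewrite !lebesgue_measure_itv/= !lte_fin ltrD2r.
by case: ifP => // _; rewrite -!EFinB; congr EFin; ring.
Qed.

(** With [q = 1 + 2 * s], completing the square gives [(x - m)^2 / 2 + s x^2 = q (x - m / q)^2 / 2 +
    m^2 s / q]: a normal density of mean [m / q] and variance [1 / q], whose peak is [sqrt q] times
    the original one. *)
Lemma normal_pdf_tilt (R : realType) (m s x : R) : 0 <= s ->
  normal_pdf m 1 x * expR (- (s * x ^+ 2)) =
  (Num.sqrt (1 + 2 * s))^-1 * expR (- (m ^+ 2 * s / (1 + 2 * s))) *
    normal_pdf (m / (1 + 2 * s)) (Num.sqrt (1 + 2 * s))^-1 x.
Proof.
move=> s0; set q := 1 + 2 * s.
have q0 : 0 < q by rewrite /q; lra.
have sq0 : 0 < Num.sqrt q by rewrite sqrtr_gt0.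
rewrite !normal_pdfE ?oner_eq0 ?invr_eq0 ?gt_eqF//.
have -> : normal_peak (Num.sqrt q)^-1 = Num.sqrt q * normal_peak 1 :> R.
  rewrite /normal_peak exprVn sqr_sqrtr ?ltW// expr1n mul1r.
  by rewrite -mulrnAr sqrtrM ?invr_ge0 ?ltW// invfM sqrtrV ?ltW// invrK.
rewrite /normal_fun exprVn sqr_sqrtr ?ltW// expr1n.
rewrite mulrACA mulKf ?gt_eqF// -!mulrA; congr (_ * _).
rewrite -!expRD; congr expR.
(* Eliminating [s] leaves a rational identity in which [q] is the only denominator to control. *)
have qE : s = (q - 1) / 2 by rewrite /q; field.
rewrite -[q^-1 *+ 2]mulr_natr qE; field.
by rewrite gt_eqF.
Qed.

Lemma integral_normal_prob (R : realType) (m s : R)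
    (f : measurableTypeR R -> \bar R) :
  measurable_fun [set: measurableTypeR R] f -> (forall x, 0 <= f x)%E ->
  (\int[normal_prob m s]_x f x =
   \int[lebesgue_measure]_x ((normal_pdf m s x)%:E * f x))%E.
Proof.
move=> mf f0.
apply: (integral_weighted_law (mu := @lebesgue_measure R)
  (h := normal_pdf m s) (Z := idfun)) => //.
- exact: measurable_normal_pdf.
- by move=> t; exact: normal_pdf_ge0.
- exact: measurable_id.
- move=> A mA; rewrite /= /normal_prob [LHS]integral_mkcond.
  apply: eq_integral => x _.
  by rewrite patchE indicE; case: ifP => _; rewrite ?mule1 ?mule0.
Qed.

Lemma laplace_normal_sqr (R : realType) (d : measure_display)
    (T : measurableType d) (P : probability T R) (Z : {RV P >-> R}) (m s : R) :
  same_law (distribution P Z) (normal_prob m 1) -> 0 <= s ->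
  (\int[P]_t (expR (- (s * Z t ^+ 2)))%:E =
   ((Num.sqrt (1 + 2 * s))^-1 * expR (- (m ^+ 2 * s / (1 + 2 * s))))%:E)%E.
Proof.
move=> ZN s0; set c := _ * expR _.
pose f (x : measurableTypeR R) := (expR (- (s * x ^+ 2)))%:E.
have mf : measurable_fun [set: measurableTypeR R] f.
  apply/measurable_EFinP/measurableT_comp => //.
  by apply: measurableT_comp => //; apply: measurable_funM.
have f0 x : (0 <= f x)%E by rewrite lee_fin expR_ge0.
transitivity (\int[normal_prob m 1]_x f x)%E.
  apply/esym/ge0_integral_law => //; last by move=> A mA; exact/esym/ZN.
  exact: (@measurable_funPT _ _ _ _ Z).
rewrite integral_normal_prob//.
under eq_integral do rewrite /f -EFinM normal_pdf_tilt// EFinM.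
rewrite ge0_integralZl//.
- by rewrite integral_normal_pdf mule1.
- by apply/measurable_EFinP; exact: measurable_normal_pdf.
- by move=> x _; rewrite lee_fin normal_pdf_ge0.
Qed.

(** This lets the means of normal variables be changed by adding constants on the same probability
    space. *)
Lemma normal_prob_shift (R : realType) (m a : R) (A : set (measurableTypeR R)) :
  measurable A ->
  normal_prob (m + a) 1 A = normal_prob m 1 ((fun x => x + a) @^-1` A).
Proof.
move=> mA.
have ma : measurable_fun [set: measurableTypeR R]
    (fun x : measurableTypeR R => x + a : measurableTypeR R).
  exact: measurable_funD.
rewrite /normal_prob integral_mkcond [RHS]integral_mkcond.
rewrite (ge0_integral_law (mu := lebesgue_measure) ma).
- apply: eq_integral => x _; rewrite !patchE.
  rewrite (_ : (x + a \in A) = (x \in (fun x => x + a) @^-1` A))//.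
  case: ifP => // _; congr EFin.
  rewrite !(normal_pdfE _ (oner_neq0 R)) /normal_fun.
  by rewrite (_ : x + a - (m + a) = x - m)//; ring.
- by move=> B mB; exact/esym/lebesgue_measure_translation.
- apply/(measurable_restrict _ _ _) => //.
  apply: measurable_funTS; apply/measurable_EFinP; exact: measurable_normal_pdf.
- move=> x; rewrite patchE; case: ifP => // _.
  by rewrite lee_fin normal_pdf_ge0.
Qed.

(** * Laplace transforms of noncentral chi-square laws *)

(* The Laplace transform at [s] of c chi^2(p, a / c). *)
Definition laplace_ncchi2 (R : realType) (c : R) (p : nat) (a s : R) : R :=
  (Num.sqrt (1 + 2 * (c * s)))^-1 ^+ p * expR (- (a * s / (1 + 2 * (c * s)))).

Lemma measurable_laplace_kernel (R : realType) (s : R) :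
  measurable_fun [set: measurableTypeR R]
    (fun y : measurableTypeR R => (expR (- (s * y)))%:E).
Proof.
apply/measurable_EFinP/measurableT_comp => //.
by apply: measurableT_comp => //; exact: measurable_funM.
Qed.

(** The exponential of the sum of squares is a product of functions of the [Z i], with values in
    [[0, 1]] because [0 <= s]. In the product of their expectations the exponents add up, so the
    means enter only through [lam]. *)
Lemma laplace_noncentral_chi2 (R : realType) (p : nat) (lam s : R)
    (nu : {measure set (measurableTypeR R) -> \bar R}) :
  noncentral_chi2 p lam nu -> 0 <= s ->
  (\int[nu]_y (expR (- (s * y)))%:E = (laplace_ncchi2 1 p lam s)%:E)%E.
Proof.
move=> [d [T [P [Z [m [indZ ZN mlam nuE]]]]]] s0.
have mS : measurable_fun [set: T]
    (fun t => \sum_(i < p) Z i t ^+ 2 : measurableTypeR R).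
  apply: measurable_sum => i; exact: measurable_funX.
rewrite (ge0_integral_law (mu := P) mS)//; last first.
  exact: measurable_laplace_kernel.
pose f (i : 'I_p) (x : R) := expR (- (s * x ^+ 2)).
transitivity (\int[P]_t (\prod_(i < p) f i (Z i t))%:E)%E.
  apply: eq_integral => t _; congr EFin.
  by rewrite /f -expR_sum mulr_sumr sumrN.
rewrite (expectation_prod_indep indZ).
- under eq_bigr do rewrite (laplace_normal_sqr (ZN _) s0).
  rewrite prodEFin big_split/= prodr_const card_ord -expR_sum sumrN.
  by rewrite /laplace_ncchi2 mul1r -!mulr_suml mlam.
- move=> i; apply: measurableT_comp => //; apply: measurableT_comp => //.
  by apply: measurable_funM => //; exact: measurable_funX.
- move=> i x; rewrite expR_ge0 -[leRHS]expR0 ler_expR oppr_le0.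
  by rewrite mulr_ge0 ?sqr_ge0.
Qed.

Lemma laplace_scaled_noncentral_chi2 (R : realType) (c : R) (p : nat) (a s : R)
    (nu : {measure set (measurableTypeR R) -> \bar R}) :
  0 < c -> scaled_noncentral_chi2 c p (a / c) nu -> 0 <= s ->
  (\int[nu]_y (expR (- (s * y)))%:E = (laplace_ncchi2 c p a s)%:E)%E.
Proof.
move=> c0 [d [T [P [W [Wchi2 nuE]]]]] s0.
have mW : measurable_fun [set: T] (fun t => c * W t : measurableTypeR R).
  exact: measurable_funM.
have mW' : measurable_fun [set: T] (W : T -> measurableTypeR R).
  exact: (@measurable_funPT _ _ _ _ W).
pose lawW : {measure set (measurableTypeR R) -> \bar R} :=
  image_measure P mW'.
have -> : laplace_ncchi2 c p a s = laplace_ncchi2 1 p (a / c) (c * s).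
  rewrite /laplace_ncchi2 mul1r (_ : a / c * (c * s) = a * s)//.
  by field; rewrite gt_eqF.
rewrite -(laplace_noncentral_chi2 (nu := lawW))//; last first.
  by rewrite mulr_ge0// ltW.
have mexp := measurable_laplace_kernel.
rewrite (ge0_integral_law (mu := P) mW)// (ge0_integral_law (mu := P) mW')//.
by apply: eq_integral => t _; rewrite mulrCA mulrA.
Qed.

(** * Uniqueness of a law on the half-line given its Laplace transform *)

Lemma bernoulli_ineq (R : realDomainType) (u : R) (n : nat) :
  0 <= u <= 1 -> 1 - n%:R * u <= (1 - u) ^+ n.
Proof.
move=> /andP[u0 u1]; elim: n => [|n IHn]; first by rewrite mul0r subr0 expr0.
have n0 : 0 <= n%:R :> R by [].
rewrite exprS (le_trans _ (ler_wpM2l _ IHn)) ?subr_ge0//.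
by rewrite -natr1; nra.
Qed.

(* The extra factor [n.+1] in the exponent makes the limit 0 also at [x = a]. *)
Definition tail_approx (R : realType) (a : R) (n : nat) (x : R) : R :=
  (1 - expR (- (n.+1%:R * x))) ^+ Num.trunc (n.+1%:R * expR (a * n.+1%:R)).

Lemma tail_approx01 (R : realType) (a : R) (n : nat) (x : R) :
  0 <= x -> 0 <= tail_approx a n x <= 1.
Proof.
move=> x0.
have e1 : expR (- (n.+1%:R * x)) <= 1.
  by rewrite -[leRHS]expR0 ler_expR oppr_le0 mulr_ge0.
have e0 := expR_ge0 (- (n.+1%:R * x)).
by rewrite exprn_ge0 ?subr_ge0// exprn_ile1// ?subr_ge0// gerBl.
Qed.

(** Write [N = n.+1], [t = expR (- (N * x))] and [K] for the exponent. Then [K t] is about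
    [N expR (N (a - x))], which tends to 0 if [a < x] and is at least [N] otherwise; accordingly
    [(1 - t)^K] tends to 1 or to 0. *)
Lemma cvg_tail_approx (R : realType) (a x : R) : 0 <= x ->
  tail_approx a n x @[n --> \oo] --> (\1_`]a, +oo[ x : R).
Proof.
move=> x0.
have N0 n : 0 < n.+1%:R :> R by [].
have K0 n : 0 <= n.+1%:R * expR (a * n.+1%:R) by rewrite mulr_ge0 ?expR_ge0.
have t01 n : 0 <= expR (- (n.+1%:R * x)) <= 1.
  by rewrite expR_ge0 -[leRHS]expR0 ler_expR oppr_le0 mulr_ge0.
rewrite indicE; have [ax|ax] := ltP a x.
  rewrite mem_set/=; last by rewrite in_itv/= ax.
  have d0 : 0 < x - a by rewrite subr_gt0.
  (* Bernoulli bounds the power below by [1 - K t]. With [y = N (x - a)], [K t <= N expR (- y)], and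
     [y^2 / 2 <= expR y] turns this into [2 / ((x - a)^2 N)]. *)
  apply: (@squeeze_cvgr _ _ _ _
    (fun n => 1 - 2 / (x - a) ^+ 2 * harmonic n) (fun=> 1));
    last exact: cvg_cst.
    apply: nearW => n; have /andP[_ ->] := tail_approx01 a n x0.
    rewrite andbT (le_trans _ (bernoulli_ineq _ (t01 n)))// lerD2l lerN2.
    have /andP[trK _] := truncn_itv (K0 n).
    rewrite (le_trans (ler_wpM2r (expR_ge0 _) trK))//.
    rewrite -[leLHS]mulrA -expRD.
    rewrite (_ : _ + _ = - (n.+1%:R * (x - a))); last by ring.
    have y0 : 0 < n.+1%:R * (x - a) by rewrite mulr_gt0.
    have := expR_ge1Dxn 1 (ltW y0); set y := _ * (x - a) in y0 * => ey.
    have {}ey : y ^+ 2 / 2 <= expR y by rewrite (le_trans _ ey)// lerDr.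
    rewrite expRN /harmonic/= ler_pdivrMr ?expR_gt0//.
    rewrite (le_trans _ (ler_wpM2l _ ey))//; last first.
      by rewrite mulr_ge0 ?invr_ge0// divr_ge0 ?sqr_ge0.
    rewrite /y le_eqVlt; apply/orP; left; apply/eqP; field.
    by rewrite nat1r !gt_eqF.
  rewrite [X in _ --> X](_ : _ = 1 - 2 / (x - a) ^+ 2 * 0); last first.
    by rewrite mulr0 subr0.
  apply: cvgB; first exact: cvg_cst.
  by apply: cvgM; [exact: cvg_cst | exact: cvg_harmonic].
rewrite memNset/=; last by rewrite in_itv/= andbT ltNge ax.
apply: (@squeeze_cvgr _ _ _ _ (fun=> 0) harmonic); last exact: cvg_harmonic.
  apply: nearW => n; have /andP[-> _]/= := tail_approx01 a n x0.
  have /andP[t0 t1] := t01 n.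
  rewrite /tail_approx; set t := expR _ in t0 t1 *; set K := Num.trunc _.
  (* Truncation gives only [N <= (K + 1) t]; the loss is [t <= 1]. *)
  have KE : n.+1%:R - 1 <= K%:R * t.
    have /andP[_ Klt] := truncn_itv (K0 n).
    have : n.+1%:R <= (K%:R + 1) * t.
      rewrite natr1 (le_trans _ (ler_wpM2r t0 (ltW Klt)))//.
      rewrite -[leRHS]mulrA -expRD ler_peMr// -[leLHS]expR0 ler_expR.
      rewrite (_ : _ + _ = n.+1%:R * (a - x)); last by ring.
      by rewrite mulr_ge0 ?subr_ge0.
    by rewrite mulrDl mul1r; lra.
  (* The bound is then the inverse of [expR (K t)], which is at least [1 + K t >= N]. *)
  have : (1 - t) ^+ K <= expR (- t) ^+ K.
    by rewrite lerXn2r ?nnegrE ?expR_ge0 ?subr_ge0// expR_ge1Dx.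
  move=> /le_trans; apply.
  rewrite -expRM_natl mulrN expRN /harmonic/= lef_pV2 ?posrE ?expR_gt0//.
  by rewrite (le_trans _ (expR_ge1Dx _))//; lra.
exact: cvg_cst.
Qed.

(** The factor [expR (- (m * x))] makes induction on [N] possible: expanding one factor
    [1 - expR (- (n * x))] gives a difference of two terms of degree [N], with [m] and [m + n] in
    place of [m]. *)
Lemma laplace_monomial (R : realType) (d d' : measure_display)
    (T : measurableType d) (T' : measurableType d')
    (P : probability T R) (P' : probability T' R)
    (X : {RV P >-> R}) (Y : {RV P' >-> R}) (N m n : nat) :
  (forall t, 0 <= X t) -> (forall t, 0 <= Y t) ->
  (forall k : nat, \int[P]_t (expR (- (k%:R * X t)))%:E =
                   \int[P']_t (expR (- (k%:R * Y t)))%:E)%E ->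
  (\int[P]_t (expR (- (m%:R * X t)) * (1 - expR (- (n%:R * X t))) ^+ N)%:E =
   \int[P']_t (expR (- (m%:R * Y t)) * (1 - expR (- (n%:R * Y t))) ^+ N)%:E)%E.
Proof.
move=> X0 Y0 XY.
pose f k M (x : R) := expR (- (k%:R * x)) * (1 - expR (- (n%:R * x))) ^+ M.
have mf k M : measurable_fun [set: R] (f k M).
  have me j : measurable_fun [set: R] (fun x : R => expR (- (j%:R * x))).
    by apply: measurableT_comp => //; exact: measurableT_comp.
  apply: measurable_funM => //; apply: measurable_funX.
  exact: measurable_funB.
have f01 k M x : 0 <= x -> 0 <= f k M x <= 1.
  move=> x0.
  have e01 j : 0 <= expR (- (j%:R * x)) <= 1.
    by rewrite expR_ge0 -[leRHS]expR0 ler_expR oppr_le0 mulr_ge0.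
  have /andP[ek0 ek1] := e01 k; have /andP[en0 en1] := e01 n.
  have pw0 : 0 <= (1 - expR (- (n%:R * x))) ^+ M by rewrite exprn_ge0 ?subr_ge0.
  by rewrite /f mulr_ge0//= mulr_ile1// exprn_ile1// ?subr_ge0// gerBl.
have fS k M x : f k M.+1 x = f k M x - f (k + n)%N M x.
  by rewrite /f natrD mulrDl opprD expRD exprS; ring.
have intf (d0 : measure_display) (T0 : measurableType d0) (Q : probability T0 R)
    (V : {RV Q >-> R}) k M : (forall t, 0 <= V t) ->
    Q.-integrable [set: T0] (EFin \o (f k M \o V)).
  move=> V0; apply: integrable_unit_valued => [|t]; last exact: f01.
  exact: measurableT_comp.
suff H : (\int[P]_t (f m N (X t))%:E = \int[P']_t (f m N (Y t))%:E)%E by [].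
elim: N m => [|N IHN] m.
  under eq_integral do rewrite /f expr0 mulr1.
  by under [RHS]eq_integral do rewrite /f expr0 mulr1.
under eq_integral do rewrite fS EFinB.
under [RHS]eq_integral do rewrite fS EFinB.
rewrite (integralB_EFin measurableT (intf _ _ P X m N X0)
  (intf _ _ P X (m + n)%N N X0)).
rewrite (integralB_EFin measurableT (intf _ _ P' Y m N Y0)
  (intf _ _ P' Y (m + n)%N N Y0)).
by rewrite /= !IHN.
Qed.

(** The rays []a, +oo[] generate the Borel sets and are stable under intersection, so agreement on
    them suffices. Their probabilities are limits, by dominated convergence, of expectations of
    [tail_approx], which the transforms determine. *)
Lemma laplace_law_unique (R : realType) (d d' : measure_display)
    (T : measurableType d) (T' : measurableType d')
    (P : probability T R) (P' : probability T' R)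
    (X : {RV P >-> R}) (Y : {RV P' >-> R}) :
  (forall t, 0 <= X t) -> (forall t, 0 <= Y t) ->
  (forall k : nat, \int[P]_t (expR (- (k%:R * X t)))%:E =
                   \int[P']_t (expR (- (k%:R * Y t)))%:E)%E ->
  same_law (distribution P X) (distribution P' Y).
Proof.
move=> X0 Y0 XY.
have mtail a n : measurable_fun [set: R] (tail_approx a n).
  apply: measurable_funX; apply: measurable_funB => //.
  by apply: measurableT_comp => //; exact: measurableT_comp.
have tailP (d0 : measure_display) (T0 : measurableType d0)
    (Q : probability T0 R) (V : {RV Q >-> R}) a : (forall t, 0 <= V t) ->
    (\int[Q]_t (tail_approx a n (V t))%:E @[n --> \oo] -->
     distribution Q V `]a, +oo[%classic)%E.
  move=> V0.
  have -> : distribution Q V `]a, +oo[%classic =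
      (\int[Q]_t (\1_`]a, +oo[ (V t))%:E)%E.
    rewrite (_ : (fun _ => _) = (EFin \o \1_(V @^-1` `]a, +oo[%classic)))//.
    by rewrite integral_indic// ?setIT//; exact: measurable_funPTI.
  have [] // := @dominated_convergence _ _ _ Q _ measurableT
    (fun n t => (tail_approx a n (V t))%:E) (fun t => (\1_`]a, +oo[ (V t))%:E)
    (cst 1%E).
  - by move=> n; apply/measurable_EFinP; exact: measurableT_comp.
  - by apply/measurable_EFinP; exact: measurableT_comp.
  - apply: aeW => t _; apply/cvg_EFin; first by apply: nearW.
    by apply: cvg_tail_approx.
  - by apply: finite_measure_integrable_cst.
  - apply: aeW => t n _; have /andP[g0 g1] := tail_approx01 a n (V0 t).
    by rewrite /= lee_fin ger0_norm.
move=> A mA.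
apply: (@measure_unique _ R R (@RGenOInfty.G R)
  (fun k => `](- k%:R), +oo[%classic) _ _ _ _
  (distribution P X) (distribution P' Y) _ _ A mA) => //.
- exact: RGenOInfty.measurableE.
- move=> _ _ [a ->] [b ->]; exists (Num.max a b).
  by apply/seteqP; split => x /=; rewrite !in_itv/= !andbT gt_max => /andP.
- by move=> k; exists (- k%:R).
- apply/seteqP; split => // x _; exists (Num.trunc `|x|).+1 => //=.
  rewrite in_itv/= andbT ltrNl (le_lt_trans (ler_norm _))// normrN.
  by have /andP[] := truncn_itv (normr_ge0 x).
- move=> _ [a ->].
  have cX := tailP _ _ P X a X0; have cY := tailP _ _ P' Y a Y0.
  rewrite (_ : (fun n => _) =
      (fun n => \int[P']_t (tail_approx a n (Y t))%:E)%E) in cX;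
    first exact: (cvg_unique _ cX cY).
  apply/funext => n.
  (* Taking [m = 0] makes the prefactor 1 and leaves exactly [tail_approx a n]. *)
  have := @laplace_monomial _ _ _ _ _ P P' X Y
    (Num.trunc (n.+1%:R * expR (a * n.+1%:R))) 0 n.+1 X0 Y0 XY.
  under eq_integral do rewrite mul0r oppr0 expR0 mul1r.
  by under [RHS]eq_integral do rewrite mul0r oppr0 expR0 mul1r.
- by move=> k; rewrite (le_lt_trans (probability_le1 _ _))// ltry.
Qed.

(** * Composition of the transforms and the law of the mixture *)

(** With [q1 = 1 + 2 c1 s], everything follows from the factorization [1 + 2 (c1 + c2) s = q1 (1 + 2
    c2 (s / q1))]. *)
Lemma laplace_ncchi2_comp (R : realType) (c1 c2 : R) (p : nat) (a s : R) :
  0 < c1 -> 0 < c2 -> 0 <= s ->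
  laplace_ncchi2 (c1 + c2) p a s =
  (Num.sqrt (1 + 2 * (c1 * s)))^-1 ^+ p *
    laplace_ncchi2 c2 p a (s / (1 + 2 * (c1 * s))).
Proof.
move=> c10 c20 s0; rewrite /laplace_ncchi2 [RHS]mulrA -exprMn -invfM.
set q1 := 1 + 2 * (c1 * s).
have q10 : 0 < q1.
  by rewrite /q1 ltr_pwDl// mulr_ge0// mulr_ge0// ltW.
have qE : 1 + 2 * ((c1 + c2) * s) = q1 * (1 + 2 * (c2 * (s / q1))).
  by rewrite /q1; field; rewrite gt_eqF.
have q20 : 0 < 1 + 2 * (c2 * (s / q1)).
  by rewrite ltr_pwDl// !mulr_ge0 ?invr_ge0// ltW.
rewrite qE sqrtrM ?ltW//; congr (_ * expR (- _)).
by rewrite invfM !mulrA.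
Qed.

Lemma laplace_scaled_noncentral_chi2_RV (R : realType) (d : measure_display)
    (T : measurableType d) (P : probability T R) (X : {RV P >-> R})
    (c : R) (p : nat) (a s : R) :
  0 < c -> scaled_noncentral_chi2 c p (a / c) (distribution P X) -> 0 <= s ->
  (\int[P]_t (expR (- (s * X t)))%:E = (laplace_ncchi2 c p a s)%:E)%E.
Proof.
move=> c0 Xchi2 s0.
have mX : measurable_fun [set: T] (X : T -> measurableTypeR R).
  exact: (@measurable_funPT _ _ _ _ X).
pose lawX : {measure set (measurableTypeR R) -> \bar R} :=
  image_measure P mX.
rewrite -(laplace_scaled_noncentral_chi2 (nu := lawX) c0 Xchi2 s0).
apply/esym/ge0_integral_law => //; exact: measurable_laplace_kernel.
Qed.

(** Multiplying every mean by [sqrt q] multiplies the sum of their squares by [q]. Adding the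
    constant [b i] to [Z i] does this while keeping independence and unit variance. Being a sum of
    squares, [W] is nonnegative at every point, as [laplace_law_unique] requires. *)
Lemma noncentral_chi2_rescale (R : realType) (p : nat) (lam q : R)
    (nu : set R -> \bar R) :
  noncentral_chi2 p lam nu -> 0 <= q ->
  exists (d : measure_display) (T : measurableType d) (P : probability T R)
    (W : {RV P >-> R}),
    noncentral_chi2 p (q * lam) (distribution P W) /\ forall t, 0 <= W t.
Proof.
move=> [d [T [P [Z [m [indZ ZN mlam _]]]]]] q0.
pose b i := (Num.sqrt q - 1) * m i.
have bE i : m i + b i = Num.sqrt q * m i by rewrite /b; ring.
have mZ i : measurable_fun [set: T] (fun t => Z i t + b i).
  exact: measurable_funD.
pose Z' i : {RV P >-> R} :=
  HB.pack (fun t => Z i t + b i) (isMeasurableFun.Build _ _ _ _ _ (mZ i)).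
have mW : measurable_fun [set: T] (fun t => \sum_(i < p) Z' i t ^+ 2).
  by apply: measurable_sum => i; exact: measurable_funX.
pose W : {RV P >-> R} :=
  HB.pack (fun t => \sum_(i < p) Z' i t ^+ 2)
    (isMeasurableFun.Build _ _ _ _ _ mW).
exists d, T, P, W; split; last first.
  by move=> t; apply: sumr_ge0 => i _; exact: sqr_ge0.
have mshift i (B : set R) : measurable B ->
    measurable ((fun x => x + b i) @^-1` B).
  move=> mB; rewrite -[X in measurable X]setTI.
  by apply: (measurable_funD _ _) => //; exact: measurable_id.
exists d, T, P, Z', (fun i => Num.sqrt q * m i); split => //.
- move=> J B mB.
  exact: (indZ J (fun i => (fun x => x + b i) @^-1` B i)
    (fun i => mshift i _ (mB i))).
- move=> i B mB; rewrite -bE normal_prob_shift//.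
  exact: (ZN i _ (mshift i _ mB)).
- under eq_bigr do rewrite exprMn.
  by rewrite -mulr_sumr mlam sqr_sqrtr.
Qed.

Theorem lemma1 (R : realType) (d : measure_display) (T : measurableType d)
    (P : probability T R) (p : nat) (c1 c2 gamma2 : R)
    (x gamma1 : {RV P >-> R}) :
  (1 <= p)%N -> 0 < c1 -> 0 < c2 -> 0 <= gamma2 ->
  (forall t, 0 <= x t) -> (forall t, 0 <= gamma1 t) ->
  (exists k : R.-pker (measurableTypeR R) ~> (measurableTypeR R),
     regular_conditional_distribution x gamma1 k /\
     {ae distribution P gamma1, forall g,
        scaled_noncentral_chi2 c1 p (g / c1) (k g)}) ->
  scaled_noncentral_chi2 c2 p (gamma2 / c2) (distribution P gamma1) ->
  scaled_noncentral_chi2 (c1 + c2) p (gamma2 / (c1 + c2)) (distribution P x).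
Proof.
move=> _ c10 c20 _ x0 _ [k [xk kchi2]] gchi2.
have c0 : 0 < c1 + c2 by rewrite addr_gt0.
have [d' [T' [P' [W [Wchi2 W0]]]]] : exists (d' : measure_display)
    (T' : measurableType d') (P' : probability T' R) (W : {RV P' >-> R}),
    noncentral_chi2 p (gamma2 / (c1 + c2)) (distribution P' W) /\
    forall t, 0 <= W t.
  (* The chi-square variable behind [gamma1] has noncentrality [gamma2 / c2], so the factor
     [c2 / (c1 + c2)] yields the required one. *)
  case: gchi2 => [? [? [? [? [+ _]]]]] => /noncentral_chi2_rescale.
  have q0 : 0 <= c2 / (c1 + c2) by rewrite divr_ge0// ltW.
  move=> /(_ _ q0); rewrite (_ : c2 / (c1 + c2) * _ = gamma2 / (c1 + c2))//.
  by field; rewrite !gt_eqF.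
have mV : measurable_fun [set: T'] (fun t => (c1 + c2) * W t).
  exact: measurable_funM.
pose V : {RV P' >-> R} :=
  HB.pack (fun t => (c1 + c2) * W t) (isMeasurableFun.Build _ _ _ _ _ mV).
have Vchi2 : scaled_noncentral_chi2 (c1 + c2) p (gamma2 / (c1 + c2))
    (distribution P' V).
  by exists d', T', P', W.
exists d', T', P', W; split => //.
apply: (laplace_law_unique (X := x) (Y := V)) => // [t|n].
  by rewrite mulr_ge0// ltW.
set s : R := n%:R.
have s0 : 0 <= s by [].
rewrite (laplace_scaled_noncentral_chi2_RV c0 Vchi2 s0).
have mx : measurable_fun [set: T] (x : T -> measurableTypeR R).
  exact: (@measurable_funPT _ _ _ _ x).
pose lawx : {measure set (measurableTypeR R) -> \bar R} :=
  image_measure P mx.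
have mexp := @measurable_laplace_kernel R.
have mk A : measurable A ->
    measurable_fun [set: R] (fun g : R => k g A : \bar R).
  move=> mA; exact: (measurable_kernel k A mA).
(* Conditioning with the whole line as [B] shows that the law of [x] is the mixture of the [k g]
   over the law of [gamma1]. *)
transitivity
  (\int[distribution P gamma1]_g \int[k g]_y (expR (- (s * y)))%:E)%E.
  rewrite -(integral_mixture (nu := lawx))//.
    by apply/esym/ge0_integral_law.
  move=> A mA; rewrite -xk//.
  by rewrite preimage_setT setIT.
set q1 := 1 + 2 * (c1 * s).
have q10 : 0 < q1.
  by rewrite /q1 ltr_pwDl// mulr_ge0// mulr_ge0// ltW.
have cst0 : 0 <= (Num.sqrt q1)^-1 ^+ p :> R by rewrite exprn_ge0 ?invr_ge0.
rewrite (laplace_ncchi2_comp _ _ c10 c20 s0) -/q1 EFinM.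
have s10 : 0 <= s / q1 by rewrite divr_ge0// ltW.
rewrite -(laplace_scaled_noncentral_chi2_RV c20 gchi2 s10).
have mexp1 : measurable_fun [set: R] (fun g : R => (expR (- (s / q1 * g)))%:E).
  exact: mexp.
rewrite -[X in (_ = _ * X)%E](ge0_integral_distribution gamma1 mexp1)//.
rewrite -ge0_integralZl//.
(* The law of [k g] is prescribed only for almost every [g], so the integrands are compared almost
   everywhere. *)
apply: ae_eq_integral => //.
- exact: measurable_fun_integral_kernel.
- exact: measurable_funeM.
apply: filterS kchi2 => g kg _ /=.
rewrite (laplace_scaled_noncentral_chi2 c10 kg s0) /laplace_ncchi2 -/q1 EFinM.
by rewrite (_ : g * s / q1 = s / q1 * g)//; ring.
Qed.
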